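(* It holds that ${\rm D}(\mathcal X,\mathcal Y)=\mathsf d_{\rm mG}(\mathcal X,\mathcal Y)$ for every $\mathcal X,\mathcal Y\in\mathbb X_1$.
   Context: ''Isometry'' means distance-preserving map (not necessarily surjective). A normalised metric measure space $({\rm X},\mathsf d,\mathfrak m)$ is a complete separable metric space with a Borel probability measure $\mathfrak m$. Two such spaces are isomorphic if there is an isometric bijection $\phi\colon{\rm spt}(\mathfrak m_{\rm X})\to{\rm spt}(\mathfrak m_{\rm Y})$ with $\phi_\#\mathfrak m_{\rm X}=\mathfrak m_{\rm Y}$. $\mathbb X_1$ is the collection of isomorphism classes $[{\rm X},\mathsf d,\mathfrak m]$ of normalised metric measure spaces. For Borel probability measures $\mu$ on ${\rm X}$ and $\nu$ on ${\rm Y}$, ${\rm Adm}(\mu;\nu)$ is the set of Borel probability measures on ${\rm X}\times{\rm Y}$ with marginals $\mu$ and $\nu$. ${\rm Cpl}(\mathsf d_{\rm X},\mathfrak m_{\rm X};\mathsf d_{\rm Y},\mathfrak m_{\rm Y})$ is the collection of all complete and separable distances $\varrho$ on the disjoint union ${\rm spt}(\mathfrak m_{\rm X})\sqcup{\rm spt}(\mathfrak m_{\rm Y})$ that restrict to $\mathsf d_{\rm X}$ on ${\rm spt}(\mathfrak m_{\rm X})$ and to $\mathsf d_{\rm Y}$ on ${\rm spt}(\mathfrak m_{\rm Y})$. For $\mathcal X=[{\rm X},\mathsf d_{\rm X},\mathfrak m_{\rm X}]$ and $\mathcal Y=[{\rm Y},\mathsf d_{\rm Y},\mathfrak m_{\rm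 Y}]$ in $\mathbb X_1$, $${\rm D}(\mathcal X,\mathcal Y):=\inf\Big\{\int\varrho\wedge 1\,{\rm d}\pi\;\Big|\;\varrho\in{\rm Cpl}(\mathsf d_{\rm X},\mathfrak m_{\rm X};\mathsf d_{\rm Y},\mathfrak m_{\rm Y}),\ \pi\in{\rm Adm}(\mathfrak m_{\rm X};\mathfrak m_{\rm Y})\Big\},$$ which is independent of representatives (each $\pi$ is concentrated on ${\rm spt}(\mathfrak m_{\rm X})\times{\rm spt}(\mathfrak m_{\rm Y})$, where $\varrho(x,y)$ is defined). $(\mathbb U,\mathsf d_{\mathbb U})$ is the Urysohn universal metric space: the unique (up to isometric bijection) complete separable metric space that is universal (every separable metric space embeds isometrically in it) and ultrahomogeneous (every isometry $\phi\colon F\to\mathbb U$ on a finite subset $F\subseteq\mathbb U$ extends to an isometric bijection of $\mathbb U$). $\mathscr P(\mathbb U)$ is the set of Borel probability measures on $\mathbb U$; $W(\mu,\nu):=\inf_{\pi\in{\rm Adm}(\mu;\nu)}\int\mathsf d_{\mathbb U}\wedge 1\,{\rm d}\pi$. For $\mu,\nu\in\mathscr P(\mathbb U)$, $\mu\sim\nu$ iff $\phi_\#\mu=\nu$ for some isometric bijection $\phi\colon{\rm spt}(\mu)\to{\rm spt}(\nu)$; $\mathscr P_\sim(\mathbb U):=\mathscr P(\mathbb U)/\sim$, and for $\theta,\eta\in\mathscr P_\sim(\mathbb U)$ $$W_H(\theta,\eta):=\max\Big\{\sup_{\mu\in\theta}\inf_{\nu\in\eta}W(\mu,\nu),\ \sup_{\nu\in\eta}\inf_{\mu\in\theta}W(\mu,\nu)\Big\}.$$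 The map $\Phi\colon\mathbb X_1\to\mathscr P_\sim(\mathbb U)$, $\Phi([{\rm X},\mathsf d,\mathfrak m]):=[f_\#\mathfrak m]$ for any isometry $f\colon{\rm X}\to\mathbb U$, is a well-defined bijection, and $\mathsf d_{\rm mG}(\mathcal X,\mathcal Y):=W_H(\Phi(\mathcal X),\Phi(\mathcal Y))$. *)

(* Defs.v *)
From HB Require Import structures.
From mathcomp Require Import all_boot all_order all_algebra.
From mathcomp Require Import generic_quotient.
From mathcomp Require Import all_classical all_reals all_analysis.
From mathcomp Require Import measurable_realfun lra.

Set Implicit Arguments.
Unset Strict Implicit.
Unset Printing Implicit Defensive.
Import Order.TTheory GRing.Theory Num.Theory.
Import numFieldTopology.Exports numFieldNormedType.Exports.
Local Open Scope classical_set_scope.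
Local Open Scope ring_scope.
Local Open Scope quotient_scope.

Definition separable (T : topologicalType) :=
  exists2 A : set T, countable A & dense A.

HB.mixin Record isSeparable T & Topological T := {
  separable_axiom : separable T
}.

(* The base point carried by completeType is irrelevant: every space below
   supports a probability measure, and no map is required to preserve it. *)
#[short(type="polishMetricType")]
HB.structure Definition PolishMetric (R : numDomainType) :=
  {T of Metric R T & Complete T & isSeparable T}.

HB.instance Definition _ (S T : ptopologicalType) := Pointed.on (S * T)%type.

(* The sigma-algebra generated by the open sets. On [X * Y] it is the Borel
   sigma-algebra of the product topology. *)
Notation borel T := (g_sigma_algebraType (@open T)).

Section Isometries.
Context {R : realType}.

Definition isometry_on (X Y : metricType R) (A : set X) (f : X -> Y) :=
  forall x y, A x -> A y -> mdist (f x) (f y) = mdist x y.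

Definition isometry (X Y : metricType R) (f : X -> Y) := isometry_on setT f.

End Isometries.

Section SupportIsomorphism.
Context {R : realType}.
Local Open Scope ereal_scope.

Definition spt (T : polishMetricType R) (m : probability (borel T) R) : set T :=
  [set x | forall V : set T, open V -> V x -> 0 < m V].

(* A map defined on [spt m] is represented by an arbitrary extension to the
   ambient space; only its values on [spt m] matter, and [m] is concentrated
   there ([spt_full]). *)
Definition spt_isom (X Y : polishMetricType R) (m : probability (borel X) R)
    (n : probability (borel Y) R) (phi : X -> Y) :=
  [/\ set_bij (spt m) (spt n) phi,
      isometry_on (spt m) phi &
      forall B : set (borel Y), measurable B -> m (spt m `&` phi @^-1` B) = n B].

Definition isomorphic (X Y : polishMetricType R) (m : probability (borel X) R)
    (n : probability (borel Y) R) :=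
  exists phi : X -> Y, spt_isom m n phi.

End SupportIsomorphism.

Section BorelFacts.
Context {R : realType}.

Lemma ball_mdist (T : metricType R) (x : T) (r : R) :
  ball x r = [set y | mdist x y < r].
Proof. exact: ballEmdist. Qed.

Lemma open_ball_metric (T : metricType R) (x : T) (r : R) : open (ball x r).
Proof.
rewrite openE => y. rewrite ball_mdist /= => xy.
have e0 : 0 < r - mdist x y by rewrite subr_gt0.
apply/nbhs_ballP; exists (r - mdist x y) => //= z.
rewrite !ball_mdist /= => yz.
by rewrite (le_lt_trans (metric_triangle x y z))// addrC -ltrBrDr.
Qed.

Lemma open_borel (T : ptopologicalType) (O : set T) :
  open O -> measurable (O : set (borel T)).
Proof. by move=> oO; apply: sub_sigma_algebra. Qed.

Lemma closed_borel (T : ptopologicalType) (A : set T) :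
  closed A -> measurable (A : set (borel T)).
Proof.
by move=> cA; rewrite -[A]setCK; apply: measurableC; apply: open_borel;
  rewrite openC.
Qed.

Lemma relopen_measurable (S : ptopologicalType) (D P : set S) :
  measurable (D : set (borel S)) ->
  (forall x, D x -> P x -> exists V : set S,
     [/\ open V, V x & V `&` D `<=` P]) ->
  measurable (D `&` P : set (borel S)).
Proof.
move=> mD H.
have -> : D `&` P = D `&` \bigcup_(V in [set V | open V /\ V `&` D `<=` P]) V.
  apply/seteqP; split=> x [Dx].
    by move=> Px; split => //; have [V [oV Vx VP]] := H _ Dx Px; exists V.
  by move=> [V [oV VP] Vx]; split => //; apply: VP.
apply: measurableI => //; apply: open_borel; apply: bigcup_open.
by move=> V [].
Qed.

Lemma relcts_measurable (S T : ptopologicalType) (D : set S) (f : S -> T) :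
  measurable (D : set (borel S)) ->
  (forall x (O : set T), D x -> open O -> O (f x) -> exists V : set S,
     [/\ open V, V x & V `&` D `<=` f @^-1` O]) ->
  measurable_fun (D : set (borel S)) (f : borel S -> borel T).
Proof.
move=> mD H.
apply: (@measurability _ _ (borel S) (borel T) D f (@open T)) => // _ [V oV <-].
by apply: relopen_measurable => // x Dx Ox; exact: H.
Qed.

Lemma isometry_on_relcts (X Y : polishMetricType R) (D : set X) (f : X -> Y) :
  isometry_on D f -> forall x (O : set Y), D x -> open O -> O (f x) ->
  exists V : set X, [/\ open V, V x & V `&` D `<=` f @^-1` O].
Proof.
move=> iD x O Dx oO Ofx.
have : nbhs (f x) O by exact: open_nbhs_nbhs.
move=> /nbhs_ballP[e /= e0 eO]; exists (ball x e); split.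
- exact: open_ball_metric.
- exact: ballxx.
- by move=> y [xy Dy]; apply: eO; move: xy; rewrite !ball_mdist /= iD.
Qed.

Lemma isometry_on_measurable (X Y : polishMetricType R) (D : set X)
    (f : X -> Y) : measurable (D : set (borel X)) -> isometry_on D f ->
  measurable_fun (D : set (borel X)) (f : borel X -> borel Y).
Proof.
by move=> mD iD; apply: relcts_measurable => //; exact: isometry_on_relcts.
Qed.

Lemma isometry_measurable (X Y : polishMetricType R) (f : X -> Y) :
  isometry f ->
  measurable_fun setT (f : borel X -> borel Y).
Proof. by move=> ?; exact: isometry_on_measurable. Qed.

End BorelFacts.

Section SupportFacts.
Context {R : realType}.
Local Open Scope ereal_scope.
Variables (T : polishMetricType R) (m : probability (borel T) R).

Lemma closed_spt : closed (spt m).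
Proof.
rewrite -openC openE => x /existsNP[V /not_implyP[oV /not_implyP[Vx mV]]].
apply: (@filterS _ (nbhs x) _ V); last exact: open_nbhs_nbhs.
by move=> y Vy /(_ V oV Vy).
Qed.

Lemma measurable_spt : measurable (spt m : set (borel T)).
Proof. exact: (closed_borel closed_spt). Qed.

Lemma sptC_negligible : m (~` spt m) = 0.
Proof.
have [A cA dA] : separable T by exact: separable_axiom.
have A0 : A !=set0.
  have [x] := dA setT (ex_intro _ point I) openT.
  by case=> _ Ax; exists x.
have /pfcard_geP[A0'|[f]] := cA; first by move: A0; rewrite A0' => -[].
pose B (n k : nat) : set (borel T) :=
  let b := ball (f n) (k.+1%:R^-1) in if m b == 0 then b else set0.
have BN n k : m.-negligible (B n k).
  rewrite /B; case: ifPn => [/eqP mb|_]; last exact: negligible_set0.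
  exists (ball (f n) (k.+1%:R^-1)); split => //.
  by apply: open_borel; exact: open_ball_metric.
have N : m.-negligible (\bigcup_n \bigcup_k B n k).
  by apply: negligible_bigcup => n; apply: negligible_bigcup => k.
have mS := measurableC measurable_spt.
apply/(negligibleP _ mS)/(negligibleS _ N) => x.
move=> /existsNP[V /not_implyP[oV /not_implyP[Vx mV]]].
have : nbhs x V by exact: open_nbhs_nbhs.
move=> /nbhs_ballP[e /= e0 eV].
pose k := Num.truncn (2 / e)%R; pose d : R := (k.+1%:R^-1)%R.
have d0 : (0 < d)%R by rewrite invr_gt0.
have de : (d + d < e)%R.
  have ke : (2 / e < k.+1%:R)%R by rewrite /k truncnS_gt.
  by rewrite -mulr2n -mulr_natl /d ltr_pdivrMr// mulrC -ltr_pdivrMr// mulrC.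
have [y [xy Ay]] := dA (ball x d) (ex_intro _ x (ballxx x d0)) (open_ball_metric x d).
have [n _ fn] := 'surj_f Ay.
exists n => //; exists k => //; rewrite /B -/d fn.
have sub : ball y d `<=` V.
  move=> z; rewrite ball_mdist /= => yz; apply: eV; rewrite ball_mdist /=.
  rewrite (le_lt_trans (metric_triangle x y z))// (lt_trans _ de)//.
  by move: xy; rewrite ball_mdist /= => xy; rewrite ltrD.
have mb : m (ball y d) = 0.
  apply/eqP; rewrite eq_le measure_ge0 andbT leNgt; apply/negP => mb.
  apply: mV; apply: (lt_le_trans mb); apply: le_measure => //; rewrite inE;
  apply: open_borel => //; exact: open_ball_metric.
rewrite mb eqxx; move: xy; rewrite !ball_mdist /= => xy.
by rewrite metric_sym.
Qed.

Lemma spt_full (A : set (borel T)) : measurable A -> m (spt m `&` A) = m A.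
Proof.
move=> mA; have mS := measurable_spt.
rewrite -[in RHS](setIT A) -(setUv (spt m)) setIUr measureU//.
- rewrite setIC [X in _ = _ + X](_ : _ = 0) ?adde0//.
  apply: (subset_measure0 _ _ _ sptC_negligible) => //.
  + by apply: measurableI => //; exact: measurableC.
  + exact: measurableC.
- exact: measurableI.
- by apply: measurableI => //; exact: measurableC.
- by rewrite setIACA setICr setI0.
Qed.

Lemma spt_setI_nonempty (V : set T) : open V -> 0 < m V -> spt m `&` V !=set0.
Proof.
move=> oV mV; apply/set0P/eqP => E.
by move: mV; rewrite -spt_full ?E ?measure0 ?ltxx//; exact: open_borel.
Qed.

End SupportFacts.

Section IsomorphismFacts.
Context {R : realType}.

Lemma isomorphic_refl (X : polishMetricType R) (m : probability (borel X) R) :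
  isomorphic m m.
Proof.
exists id; split => //.
- by split => // x Sx; exists x.
- by move=> B mB; rewrite preimage_id spt_full.
Qed.

Lemma spt_isom_measurable (X Y : polishMetricType R)
    (m : probability (borel X) R) (n : probability (borel Y) R) (phi : X -> Y) :
  spt_isom m n phi ->
  measurable_fun (spt m : set (borel X)) (phi : borel X -> borel Y).
Proof.
by case=> _ iphi _; apply: isometry_on_measurable => //; exact: measurable_spt.
Qed.

Lemma spt_isom_inv (X Y : polishMetricType R) (m : probability (borel X) R)
    (n : probability (borel Y) R) (phi : X -> Y) :
  spt_isom m n phi -> exists psi : Y -> X, [/\ spt_isom n m psi,
    forall x, spt m x -> psi (phi x) = x &
    forall y, spt n y -> phi (psi y) = y].
Proof.
move=> hphi; have mphi := spt_isom_measurable hphi.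
case: hphi => -[hfun hinj hsurj] iphi pphi.
pose psi y := xget point [set x | spt m x /\ phi x = y].
have psiP y : spt n y -> spt m (psi y) /\ phi (psi y) = y.
  move=> /hsurj[x Sx xy].
  exact: (@xgetPex _ point [set x | spt m x /\ phi x = y] (ex_intro _ x (conj Sx xy))).
have psiK x : spt m x -> psi (phi x) = x.
  move=> Sx; have [Sp pE] := psiP _ (hfun _ Sx).
  by apply: hinj; rewrite ?inE.
exists psi; split => //; last by move=> y /psiP[].
split.
- split.
  + by move=> y /psiP[].
  + move=> y y'; rewrite !inE => /psiP[_ {2}<-] /psiP[_ {2}<-].
    by move=> ->.
  + by move=> x Sx; exists (phi x); [exact: hfun|exact: psiK].
- move=> y y' /psiP[Sy {2}<-] /psiP[Sy' {2}<-].
  by rewrite iphi.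
- move=> A mA.
  have E : spt m `&` phi @^-1` (spt n `&` psi @^-1` A) = spt m `&` A.
    apply/seteqP; split=> x /= [Sx].
      by move=> [_]; rewrite psiK.
    by move=> Ax; split => //; split; [exact: hfun|rewrite psiK].
  rewrite -(spt_full m mA) -E pphi//.
  apply: isometry_on_measurable => //; try exact: measurable_spt.
  move=> y y' /psiP[Sy {2}<-] /psiP[Sy' {2}<-].
  by rewrite iphi.
Qed.

Lemma isomorphic_sym (X Y : polishMetricType R) (m : probability (borel X) R)
    (n : probability (borel Y) R) : isomorphic m n -> isomorphic n m.
Proof. by move=> [phi /spt_isom_inv[psi [? _ _]]]; exists psi. Qed.

Lemma isomorphic_trans (X Y Z : polishMetricType R)
    (m : probability (borel X) R) (n : probability (borel Y) R)
    (p : probability (borel Z) R) :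
  isomorphic m n -> isomorphic n p -> isomorphic m p.
Proof.
move=> [f hf] [g hg]; have mg := spt_isom_measurable hg.
case: hf => bf isf pf; case: hg => bg isg pg.
have hfun x : spt m x -> spt n (f x) by case: bf => + _ _; apply.
exists (g \o f); split.
- exact: set_bij_comp bf bg.
- by move=> x x' Sx Sx' /=; rewrite isg ?isf//; exact: hfun.
- move=> B mB; rewrite -pg// -pf; last by apply: mg => //; exact: measurable_spt.
  congr (m _); apply/seteqP; split=> x /= [Sx Bx]; split => //.
    by split => //; exact: hfun.
  by case: Bx.
Qed.

Section IsometricPush.
Variables (X Y : polishMetricType R) (m : probability (borel X) R).
Variables (f : X -> Y) (hf : isometry f).

(* The proof is an argument so that the instance below can depend on it. *)
Definition isometric_fun (_ : isometry f) : borel X -> borel Y := f.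

HB.instance Definition _ := @isMeasurableFun.Build _ _ (borel X) (borel Y)
  (isometric_fun hf) (isometry_measurable hf).

Definition isometric_push : probability (borel Y) R :=
  distribution m (isometric_fun hf).

Lemma isometric_pushE (A : set (borel Y)) : isometric_push A = m (f @^-1` A).
Proof. by []. Qed.

Lemma isometric_push_isom : spt_isom m isometric_push f.
Proof.
have fwd x : spt m x -> spt isometric_push (f x).
  move=> Sx V oV Vfx; rewrite isometric_pushE.
  have [U [oU Ux UV]] := isometry_on_relcts hf (I : setT x) oV Vfx.
  apply: (lt_le_trans (Sx U oU Ux)); apply: le_measure; rewrite ?inE.
  - exact: open_borel.
  - rewrite -[X in measurable X]setTI; apply: (isometry_measurable hf) => //.
    exact: open_borel.
  - by move=> z Uz; apply: UV.
have inj : {in spt m &, injective f}.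
  by move=> x x' _ _ E; apply: mdist_positivity; rewrite -hf// E mdistxx.
have surj : set_surj (spt m) (spt isometric_push) f.
  move=> y Sy.
  pose B (e : R) := spt m `&` f @^-1` ball y e.
  pose F : set_system X := filter_from [set e : R | 0 < e] B.
  have F_filter : ProperFilter F.
    apply: filter_from_proper; last first.
      move=> e /= e0; apply: spt_setI_nonempty.
        rewrite openE => x yfx.
        have [U [oU Ux UV]] :=
          isometry_on_relcts hf (I : setT x) (open_ball_metric y e) yfx.
        apply: (@filterS _ (nbhs x) _ U); last exact: open_nbhs_nbhs.
        by move=> z Uz; apply: UV.
      exact: (Sy _ (open_ball_metric y e) (ballxx y e0)).
    apply: filter_from_filter; first by exists 1 => /=.
    move=> e e' /= e0 e'0; exists (Num.min e e') => /=; first by rewrite lt_min e0.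
    move=> x [Sx]; rewrite /B /= ball_mdist /= lt_min => /andP[xe xe'].
    by split; split => //=; rewrite ball_mdist.
  have F_cauchy : cauchy F.
    apply: cauchy_exP => e e0; have e20 : 0 < e / 2 by rewrite divr_gt0.
    have [x [Sx yx]] : B (e / 2) !=set0.
      by apply: (@filter_ex _ F); exists (e / 2).
    exists x; exists (e / 2) => // z [Sz yz]; rewrite ball_mdist /= -hf//.
    rewrite (le_lt_trans (metric_triangle _ y _))// [ltRHS]splitr.
    by move: yx yz; rewrite /= !ball_mdist /= metric_sym => yx yz; rewrite ltrD.
  have [x Fx] := (cvg_ex F).1 (cauchy_cvg F F_cauchy).
  have Sx : spt m x.
    apply: (@closed_spt _ _ m) => V xV; apply: (@filter_ex _ F).
    apply: filterI; last exact: Fx.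
    by exists 1 => /= [|z []//]; exact: ltr01.
  exists x => //; apply: mdist_positivity; apply/eqP.
  rewrite eq_le mdist_ge0 andbT; apply/ler_addgt0Pl => e e0; rewrite addr0.
  have e20 : 0 < e / 2 by rewrite divr_gt0.
  have [z [xz [Sz yz]]] : (ball x (e / 2) `&` B (e / 2)) !=set0.
    apply: (@filter_ex _ F); apply: filterI; last by exists (e / 2).
    by apply: Fx; exact: nbhsx_ballx.
  apply/ltW/(le_lt_trans (metric_triangle _ (f z) _)); rewrite [ltRHS]splitr.
  rewrite hf//; move: xz yz; rewrite /= !ball_mdist /= => xz yz.
  by rewrite ltrD// metric_sym.
split => //.
- by move=> x x' _ _; exact: hf.
- by move=> A mA; rewrite isometric_pushE spt_full//;
    rewrite -[X in measurable X]setTI; exact: (isometry_measurable hf).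
Qed.

End IsometricPush.

End IsomorphismFacts.

Section Transport.
Context {R : realType}.
Local Open Scope ereal_scope.

Definition Adm (X Y : polishMetricType R) (m : probability (borel X) R)
    (n : probability (borel Y) R) : set (probability (borel (X * Y)%type) R) :=
  [set pi | (forall A : set (borel X), measurable A ->
               pi ((fst : X * Y -> X) @^-1` A) = m A) /\
            (forall B : set (borel Y), measurable B ->
               pi ((snd : X * Y -> Y) @^-1` B) = n B)].

(* Costs lie in [0, 1], so taking infima and suprema in \bar R instead of R is
   harmless as long as the sets are nonempty, which is always the case here. *)
Definition W (U : polishMetricType R) (mu nu : probability (borel U) R) :
    \bar R :=
  ereal_inf [set \int[pi]_z (Num.min (mdist z.1 z.2) 1)%:E | pi in Adm mu nu].

End Transport.

Section Couplings.
Context {R : realType}.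

Record distance_on (T : Type) (S : set T) (rho : T -> T -> R) : Prop := {
  distance_refl : forall x, S x -> rho x x = 0;
  distance_separated : forall x y, S x -> S y -> rho x y = 0 -> x = y;
  distance_sym : forall x y, S x -> S y -> rho x y = rho y x;
  distance_triangle : forall y x z, S x -> S y -> S z ->
    rho x z <= rho x y + rho y z }.

Definition complete_on (T : Type) (S : set T) (rho : T -> T -> R) :=
  forall u : nat -> T, (forall k, S (u k)) ->
    (forall e : R, 0 < e -> exists N, forall i j, (N <= i)%N -> (N <= j)%N ->
       rho (u i) (u j) < e) ->
    exists2 x, S x & forall e : R, 0 < e -> exists N, forall i, (N <= i)%N ->
       rho (u i) x < e.

Definition separable_on (T : Type) (S : set T) (rho : T -> T -> R) :=
  exists2 A : set T, countable A /\ A `<=` S &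
    forall x (e : R), S x -> 0 < e -> exists2 a, A a & rho x a < e.

Section Cpl.
Variables (X Y : polishMetricType R).
Variables (m : probability (borel X) R) (n : probability (borel Y) R).

(* The disjoint union of the supports, as a subset of the sum type. *)
Definition spt_sum : set (X + Y) :=
  [set z | match z with inl x => spt m x | inr y => spt n y end].

(* A distance on [spt m] + [spt n] is represented by a function on X + Y whose
   values outside of [spt_sum] are arbitrary and never used. *)
Definition Cpl : set (X + Y -> X + Y -> R) :=
  [set rho | [/\ distance_on spt_sum rho,
    complete_on spt_sum rho,
    separable_on spt_sum rho,
    (forall x x', spt m x -> spt m x' -> rho (inl x) (inl x') = mdist x x') &
    (forall y y', spt n y -> spt n y' -> rho (inr y) (inr y') = mdist y y')]].

Definition cpl_cost (rho : X + Y -> X + Y -> R)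
    (pi : probability (borel (X * Y)%type) R) : \bar R :=
  (\int[pi]_(z in spt m `*` spt n) (Num.min (rho (inl z.1) (inr z.2)) 1)%:E)%E.

Definition D_measures : \bar R :=
  ereal_inf [set cpl_cost rho pi | rho in Cpl & pi in Adm m n].

End Cpl.
End Couplings.

Section CouplingInvariance.
Context {R : realType}.

Lemma openX_prod (S T : topologicalType) (A : set S) (B : set T) :
  open A -> open B -> open (A `*` B).
Proof.
move=> oA oB; rewrite openE => -[a b] [/= Aa Bb]; exists (A, B) => //=.
by split; apply: open_nbhs_nbhs.
Qed.

Section Product.
Variables (X Y : polishMetricType R).
Variables (m : probability (borel X) R) (n : probability (borel Y) R).

Lemma measurable_fst_borel :
  measurable_fun setT ((fst : X * Y -> X) : borel (X * Y)%type -> borel X).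
Proof.
apply: (@relcts_measurable [the ptopologicalType of (X * Y)%type] X setT fst) => // -[x y] V _ oV Vx.
by exists (V `*` setT); split => //; [apply: openX_prod => //; exact: openT|
  move=> z [[]]].
Qed.

Lemma measurable_snd_borel :
  measurable_fun setT ((snd : X * Y -> Y) : borel (X * Y)%type -> borel Y).
Proof.
apply: (@relcts_measurable [the ptopologicalType of (X * Y)%type] Y setT snd) => // -[x y] V _ oV Vx.
by exists (setT `*` V); split => //; [apply: openX_prod => //; exact: openT|
  move=> z [[]]].
Qed.

Lemma measurable_fst_preimage (A : set (borel X)) : measurable A ->
  measurable ((fst : X * Y -> X) @^-1` A : set (borel (X * Y)%type)).
Proof.
by move=> mA; rewrite -[X in measurable X]setTI; exact: measurable_fst_borel.
Qed.

Lemma measurable_snd_preimage (A : set (borel Y)) : measurable A ->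
  measurable ((snd : X * Y -> Y) @^-1` A : set (borel (X * Y)%type)).
Proof.
by move=> mA; rewrite -[X in measurable X]setTI; exact: measurable_snd_borel.
Qed.

Lemma measurable_sptX :
  measurable (spt m `*` spt n : set (borel (X * Y)%type)).
Proof.
rewrite (_ : spt m `*` spt n = (fst : X * Y -> X) @^-1` spt m
  `&` (snd : X * Y -> Y) @^-1` spt n)//.
apply: measurableI; [apply: measurable_fst_preimage|
  apply: measurable_snd_preimage]; exact: measurable_spt.
Qed.

Lemma Adm_sptXC (pi : probability (borel (X * Y)%type) R) : Adm m n pi ->
  pi (~` (spt m `*` spt n)) = 0%E.
Proof.
move=> [p1 p2]; have mC := measurableC measurable_sptX.
have mS1 := measurableC (measurable_spt m).
have mS2 := measurableC (measurable_spt n).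
apply/(negligibleP pi mC).
apply: (@negligibleS _ _ _ pi ((fst : X * Y -> X) @^-1` (~` spt m) `|`
  (snd : X * Y -> Y) @^-1` (~` spt n))).
  by move=> [x y] /not_andP[]; [left|right].
apply: negligibleU.
- have h := measurable_fst_preimage mS1.
  by apply/(negligibleP pi h); exact: etrans (p1 _ mS1) (sptC_negligible m).
- have h := measurable_snd_preimage mS2.
  by apply/(negligibleP pi h); exact: etrans (p2 _ mS2) (sptC_negligible n).
Qed.

Lemma Adm_full (pi : probability (borel (X * Y)%type) R)
    (A : set (borel (X * Y)%type)) : Adm m n pi ->
  measurable A -> pi (spt m `*` spt n `&` A) = pi A.
Proof.
move=> hpi mA; have mS := measurable_sptX; have mC := measurableC mS.
rewrite -[in RHS](setIT A) -(setUv (spt m `*` spt n)) setIUr measureU//.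
- rewrite setIC [X in (_ = _ + X)%E](_ : _ = 0%E) ?adde0//.
  apply: (subset_measure0 _ _ _ (Adm_sptXC hpi)) => //.
  exact: measurableI.
- exact: measurableI.
- exact: measurableI.
- by rewrite setIACA setICr setI0.
Qed.

Lemma cpl_cost_measurable (rho : X + Y -> X + Y -> R) : Cpl m n rho ->
  measurable_fun (spt m `*` spt n : set (borel (X * Y)%type))
    ((fun z => (Num.min (rho (inl z.1) (inr z.2)) 1)%:E)
      : borel (X * Y)%type -> \bar R).
Proof.
move=> [[r0 _ rS rT] _ _ rX rY]; apply/measurable_EFinP.
apply: measurable_minr; last exact: measurable_cst.
move=> mD.
apply: (measurability _ (RGenOInfty.measurableE R)) => //.
move=> _ [_ [c ->] <-].
apply: (@relopen_measurable [the ptopologicalType of (X * Y)%type]) => // -[x y] [/= Sx Sy].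
rewrite in_itv /= andbT => cr.
pose e := (rho (inl x) (inr y) - c) / 2.
have e0 : 0 < e by rewrite divr_gt0// subr_gt0.
exists (ball x e `*` ball y e); split.
- by apply: openX_prod; exact: open_ball_metric.
- by split; exact: ballxx.
- move=> [a b] [[/= xa yb] [/= Sa Sb]]; rewrite in_itv /= andbT.
  have h1 := rT (inl a) (inl x) (inr y) Sx Sa Sy.
  have h2 := rT (inr b) (inl a) (inr y) Sa Sb Sy.
  rewrite rX// in h1; rewrite rY// [mdist b y]metric_sym in h2.
  move: xa yb; rewrite !ball_mdist /= /e => xa yb.
  lra.
Qed.

End Product.

Lemma D_measures_le (X Y X' Y' : polishMetricType R)
    (m : probability (borel X) R) (n : probability (borel Y) R)
    (m' : probability (borel X') R) (n' : probability (borel Y') R) :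
  isomorphic m m' -> isomorphic n n' -> (D_measures m n <= D_measures m' n')%E.
Proof.
move=> [f hf] [g hg].
have [f' [hf' fK f'K]] := spt_isom_inv hf.
have [g' [hg' gK g'K]] := spt_isom_inv hg.
have [[ff finj _] fi _] := hf; have [[gf ginj _] gi _] := hg.
have [[ff' finj' _] fi' fp'] := hf'; have [[gf' ginj' _] gi' gp'] := hg'.
apply: le_ereal_inf_tmp => _ [rho hrho [pi hpi <-]].
pose F (z : X + Y) : X' + Y' :=
  match z with inl x => inl (f x) | inr y => inr (g y) end.
pose G (z : X' + Y') : X + Y :=
  match z with inl x => inl (f' x) | inr y => inr (g' y) end.
have FS z : spt_sum m n z -> spt_sum m' n' (F z).
  by case: z => [x|y] /=; [exact: ff|exact: gf].
have GS z : spt_sum m' n' z -> spt_sum m n (G z).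
  by case: z => [x|y] /=; [exact: ff'|exact: gf'].
have FK z : spt_sum m n z -> G (F z) = z.
  by case: z => [x|y] /= S; rewrite ?fK ?gK.
have GK z : spt_sum m' n' z -> F (G z) = z.
  by case: z => [x|y] /= S; rewrite ?f'K ?g'K.
pose rho2 a b := rho (F a) (F b).
have hrho2 : Cpl m n rho2.
  case: (hrho) => -[r0 rP rS rT] rC [A [cA AS] rA] rX rY; split.
  - split.
    + by move=> z Sz; apply: r0; exact: FS.
    + move=> z w Sz Sw /(rP _ _ (FS _ Sz) (FS _ Sw)) E.
      by rewrite -(FK z)// E FK.
    + by move=> z w Sz Sw; apply: rS; exact: FS.
    + by move=> y x z Sx Sy Sz; apply: rT; exact: FS.
  - move=> u uS uC.
    have [z Sz zl] := rC (F \o u) (fun k => FS _ (uS k)) uC.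
    exists (G z); first exact: GS.
    by move=> e e0; rewrite /rho2 GK//; exact: zl.
  - exists (G @` A).
      split; last by move=> _ [a Aa <-]; apply: GS; exact: AS.
      exact: (sub_countable (card_image_le _ _)).
    move=> x e Sx e0; have [a Aa xa] := rA (F x) e (FS _ Sx) e0.
    by exists (G a); [exists a|rewrite /rho2 GK//; exact: AS].
  - by move=> x x' Sx Sx'; rewrite /rho2 /= rX ?fi//; exact: ff.
  - by move=> y y' Sy Sy'; rewrite /rho2 /= rY ?gi//; exact: gf.
pose S := spt m `*` spt n; pose S' := spt m' `*` spt n'.
have mS : measurable (S : set (borel (X * Y)%type)) by exact: measurable_sptX.
have mS' : measurable (S' : set (borel (X' * Y')%type)).
  exact: measurable_sptX.
pose k (z : X' * Y') : X * Y := (f' z.1, g' z.2).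
have mk : measurable_fun (S' : set (borel (X' * Y')%type))
    (k : borel (X' * Y')%type -> borel (X * Y)%type).
  apply: (@relcts_measurable [the ptopologicalType of (X' * Y')%type]
    [the ptopologicalType of (X * Y)%type] S' k) => //.
  move=> [x y] V [/= Sx Sy]; rewrite openE => + Vxy.
  move=> /(_ _ Vxy)[[A B] [/= xA yB] ABV].
  have [U1 [oU1 U1x U1A]] :=
    isometry_on_relcts fi' Sx (@open_interior _ A) xA.
  have [U2 [oU2 U2y U2B]] :=
    isometry_on_relcts gi' Sy (@open_interior _ B) yB.
  exists (U1 `*` U2); split => //; first exact: openX_prod.
  move=> [a b] [[/= U1a U2b] [/= Sa Sb]]; apply: ABV; split => /=.
    by apply: interior_subset; apply: U1A.
  by apply: interior_subset; apply: U2B.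
pose h (z : X' * Y') : X * Y := if z \in S' then k z else point.
have hE z : S' z -> h z = k z by move=> Sz; rewrite /h mem_set.
have mh : measurable_fun setT
    (h : borel (X' * Y')%type -> borel (X * Y)%type).
  move=> _ B mB; rewrite setTI.
  have -> : h @^-1` B = (S' `&` k @^-1` B) `|`
      (~` S' `&` (cst (point : (X * Y)%type) : X' * Y' -> X * Y) @^-1` B).
    apply/seteqP; split=> z /=.
      rewrite /h; case: ifPn => [/set_mem Sz Bz|/negP Sz Bz]; first by left.
      by right; split => // /mem_set.
    move=> [[Sz]|[Sz]] /= Bz; first by rewrite hE.
    by rewrite /h; case: ifPn => // /set_mem.
  apply: measurableU; first exact: mk.
  apply: measurableI; first exact: measurableC.
  have [Bp|nBp] := pselect (B point).
    by rewrite (_ : _ @^-1` B = setT)//; apply/seteqP; split.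
  by rewrite (_ : _ @^-1` B = set0)//; apply/seteqP; split.
have mhB (B : set (borel (X * Y)%type)) : measurable B ->
    measurable (h @^-1` B : set (borel (X' * Y')%type)).
  by move=> mB; rewrite -[X in measurable X]setTI; exact: mh.
pose hm : {mfun borel (X' * Y')%type >-> borel (X * Y)%type} :=
  HB.pack (h : borel (X' * Y')%type -> borel (X * Y)%type)
    (isMeasurableFun.Build _ _ _ _ _ mh).
pose pi2 : probability (borel (X * Y)%type) R := distribution pi hm.
have pi2E B : pi2 B = pi (h @^-1` B) by [].
have [q1 q2] := hpi.
have hpi2 : Adm m n pi2.
  split=> B mB.
    rewrite pi2E -(Adm_full hpi); last first.
      exact: (mhB _ (@measurable_fst_preimage X Y _ mB)).
    have mA : measurable (spt m' `&` f' @^-1` B : set (borel X')).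
      have h1 := spt_isom_measurable hf'.
      exact: (h1 (measurable_spt m')).
    have -> : m B =
        pi ((fst : X' * Y' -> X') @^-1` (spt m' `&` f' @^-1` B)).
      by rewrite -fp'//; apply/esym/q1.
    rewrite -[RHS](Adm_full hpi); last first.
      exact: (@measurable_fst_preimage X' Y' _ mA).
    congr (pi _); apply/seteqP; split=> -[x y] /= [[/= Sx Sy]].
      by rewrite hE//= => Bx; split.
    by move=> [_ Bx]; split => //; rewrite hE.
    rewrite pi2E -(Adm_full hpi); last first.
      exact: (mhB _ (@measurable_snd_preimage X Y _ mB)).
    have mA : measurable (spt n' `&` g' @^-1` B : set (borel Y')).
      have h1 := spt_isom_measurable hg'.
      exact: (h1 (measurable_spt n')).
    have -> : n B =
        pi ((snd : X' * Y' -> Y') @^-1` (spt n' `&` g' @^-1` B)).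
      by rewrite -gp'//; apply/esym/q2.
    rewrite -[RHS](Adm_full hpi); last first.
      exact: (@measurable_snd_preimage X' Y' _ mA).
    congr (pi _); apply/seteqP; split=> -[x y] /= [[/= Sx Sy]].
      by rewrite hE//= => Bx; split.
    by move=> [_ Bx]; split => //; rewrite hE.
apply: ge_ereal_inf; exists (cpl_cost m n rho2 pi2).
  by exists rho2 => //; exists pi2.
have rge0 z : S z -> (0 <= (Num.min (rho2 (inl z.1) (inr z.2)) 1)%:E)%E.
  case: z => x y [/= Sx Sy]; rewrite lee_fin le_min ler01 andbT.
  case: hrho2 => -[r0 _ rS rT] _ _ _ _.
  have := rT (inr y) (inl x) (inl x) Sx Sy Sx.
  rewrite r0// (rS (inr y))//; lra.
rewrite /cpl_cost (ge0_integral_pushforward mh)//; first last.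
- by move=> z; rewrite inE; exact: rge0.
- exact: cpl_cost_measurable.
have NS : pi (~` S') = 0%E by exact: Adm_sptXC.
rewrite (ge0_negligible_integral (measurableC mS') _ _ _ NS)//; first last.
- by move=> z; exact: rge0.
- apply: (measurable_comp mS).
  + by move=> _ [z hz <-].
  + exact: cpl_cost_measurable.
  + exact: (measurable_funS _ _ mh).
- exact: mhB.
rewrite (_ : _ `\` ~` S' = S'); last first.
  apply/seteqP; split=> z; first by move=> [_] /contrapT.
  move=> Sz; split; last by apply.
  by rewrite /= hE//; case: Sz => *; split; [exact: ff'|exact: gf'].
rewrite le_eqVlt; apply/orP; left; apply/eqP; apply: eq_integral => z.
rewrite inE => Sz /=; rewrite hE// /rho2 /= f'K ?g'K//; by case: Sz.
Qed.

Lemma D_measures_isom (X Y X' Y' : polishMetricType R)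
    (m : probability (borel X) R) (n : probability (borel Y) R)
    (m' : probability (borel X') R) (n' : probability (borel Y') R) :
  isomorphic m m' -> isomorphic n n' -> D_measures m n = D_measures m' n'.
Proof.
move=> mm nn; apply/eqP; rewrite eq_le !D_measures_le//; exact: isomorphic_sym.
Qed.

End CouplingInvariance.

Record mmspace (R : realType) := MMSpace {
  mm_type :> polishMetricType R;
  mm_measure : probability (borel mm_type) R
}.

HB.instance Definition _ (R : realType) := gen_eqMixin (mmspace R).
HB.instance Definition _ (R : realType) := gen_choiceMixin (mmspace R).

Section Quotients.
Context {R : realType}.

Definition mm_isom (X Y : mmspace R) :=
  `[< isomorphic (mm_measure X) (mm_measure Y) >].

Lemma mm_isom_refl : reflexive mm_isom.
Proof. by move=> X; apply/asboolP; exact: isomorphic_refl. Qed.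

Lemma mm_isom_sym : symmetric mm_isom.
Proof.
by move=> X Y; apply/asboolP/asboolP; exact: isomorphic_sym.
Qed.

Lemma mm_isom_trans : transitive mm_isom.
Proof.
move=> Y X Z /asboolP XY /asboolP YZ; apply/asboolP.
exact: isomorphic_trans XY YZ.
Qed.

Canonical mm_isom_equiv := EquivRel mm_isom mm_isom_refl mm_isom_sym
  mm_isom_trans.

Definition X1 : Type := {eq_quot mm_isom}.

Section Measures.
Variable U : polishMetricType R.

Definition meas_isom (mu nu : probability (borel U) R) := `[< isomorphic mu nu >].

Lemma meas_isom_refl : reflexive meas_isom.
Proof. by move=> m; apply/asboolP; exact: isomorphic_refl. Qed.

Lemma meas_isom_sym : symmetric meas_isom.
Proof.
by move=> m n; apply/asboolP/asboolP; exact: isomorphic_sym.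
Qed.

Lemma meas_isom_trans : transitive meas_isom.
Proof.
move=> n m p /asboolP mn /asboolP np; apply/asboolP.
exact: isomorphic_trans mn np.
Qed.

Canonical meas_isom_equiv := EquivRel meas_isom meas_isom_refl meas_isom_sym
  meas_isom_trans.

Definition Psim : Type := {eq_quot meas_isom}.

End Measures.
End Quotients.
Arguments X1 : clear implicits.
HB.instance Definition _ (R : realType) := EqQuotient.on (X1 R).

HB.instance Definition _ (R : realType) (U : polishMetricType R) :=
  EqQuotient.on (Psim U).

Section ClassDistances.
Context {R : realType}.

Definition mm_class (X : mmspace R) : X1 R := \pi_(X1 R) X.

Definition meas_class (U : polishMetricType R) (mu : probability (borel U) R) :
  Psim U := \pi_(Psim U) mu.

Lemma mm_classP (X Y : mmspace R) :
  mm_class X = mm_class Y <-> isomorphic (mm_measure X) (mm_measure Y).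
Proof.
split=> [E|XY].
  by apply/asboolP; apply/(@eqmodP _ (@mm_isom_equiv R) X Y).
by apply/(@eqmodP _ (@mm_isom_equiv R) X Y)/asboolP.
Qed.

Lemma meas_classP (U : polishMetricType R) (mu nu : probability (borel U) R) :
  meas_class mu = meas_class nu <-> isomorphic mu nu.
Proof.
split=> [E|mn].
  by apply/asboolP; apply/(@eqmodP _ (@meas_isom_equiv R U) mu nu).
by apply/(@eqmodP _ (@meas_isom_equiv R U) mu nu)/asboolP.
Qed.

Lemma mm_class_repr (x : X1 R) : mm_class (repr x) = x.
Proof. exact: reprK. Qed.

Definition D (x y : X1 R) : \bar R :=
  D_measures (mm_measure (repr x)) (mm_measure (repr y)).

(* Independence of the representatives. *)
Lemma DE (X Y : mmspace R) :
  D (mm_class X) (mm_class Y) = D_measures (mm_measure X) (mm_measure Y).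
Proof. by apply: D_measures_isom; apply/mm_classP; rewrite mm_class_repr. Qed.

Record is_urysohn (U : polishMetricType R) : Prop := {
  urysohn_universal : forall X : metricType R, separable X ->
    exists f : X -> U, isometry f;
  urysohn_ultrahomogeneous : forall (F : set U) (phi : U -> U),
    finite_set F -> isometry_on F phi ->
    exists psi : U -> U,
      [/\ isometry psi, bijective psi & forall x, F x -> psi x = phi x] }.

Section Urysohn.
Context {U : polishMetricType R}.
Local Open Scope ereal_scope.

Definition W_H (theta eta : Psim U) : \bar R :=
  maxe
    (ereal_sup
      [set ereal_inf [set W mu nu | nu in [set nu | meas_class nu = eta]]
      | mu in [set mu | meas_class mu = theta]])
    (ereal_sup
      [set ereal_inf [set W mu nu | mu in [set mu | meas_class mu = theta]]
      | nu in [set nu | meas_class nu = eta]]).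

Variable hU : is_urysohn U.

Definition embedding (X : mmspace R) : {f : X -> U | isometry f} :=
  cid (urysohn_universal hU (separable_axiom (s := X))).

Definition Phi (x : X1 R) : Psim U :=
  meas_class (isometric_push (mm_measure (repr x)) (svalP (embedding (repr x)))).

(* Independence of the representative and of the isometry. *)
Lemma PhiE (X : mmspace R) (f : X -> U) (hf : isometry f) :
  Phi (mm_class X) = meas_class (isometric_push (mm_measure X) hf).
Proof.
apply/meas_classP.
apply: (@isomorphic_trans _ _ _ _ _ (mm_measure (repr (mm_class X)))).
  by apply: isomorphic_sym; eexists; exact: isometric_push_isom.
apply: (@isomorphic_trans _ _ _ _ _ (mm_measure X)).
  by apply/mm_classP; rewrite mm_class_repr.
by eexists; exact: isometric_push_isom.
Qed.

Definition d_mG (x y : X1 R) : \bar R := W_H (Phi x) (Phi y).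

End Urysohn.
End ClassDistances.

(* Main.v *)
Require Import Defs.
From HB Require Import structures.
From mathcomp Require Import all_boot all_order all_algebra.
From mathcomp Require Import all_classical all_reals all_analysis.
From mathcomp Require Import measurable_realfun lra.

(* For D <= d_mG, measures mu and nu on the Urysohn space U are coupled by the
   restriction of the distance of U; adding c > 0 between the two copies makes
   it separate points of the disjoint union, and c is sent to 0.
   For d_mG <= D, fix mu in U and a coupling distance rho, and embed
   (spt mu + spt nu, rho) in U. All but e of the mass of mu lies near a finite
   set F, and ultrahomogeneity moves the copy of F back to F; the copy of
   spt mu is then within e of spt mu off a set of mass at most e, so the moved
   copy of nu is, up to 2e, as close to mu as rho allows. This works with the
   roles of mu and nu exchanged, so both suprema in W_H are bounded. *)

Set Implicit Arguments.
Unset Strict Implicit.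
Unset Printing Implicit Defensive.
Import Order.TTheory GRing.Theory Num.Theory.
Import numFieldTopology.Exports numFieldNormedType.Exports.
Local Open Scope classical_set_scope.
Local Open Scope ring_scope.

(** * Completeness and separability of subsets of a Polish space *)

Section Subsets.
Context {R : realType}.

Lemma closed_complete_on (T : polishMetricType R) (A : set T) :
  closed A -> complete_on A (@mdist R T).
Proof.
move=> cA u uA uC.
have /cauchy_cvg ucvg : cauchy (u @ \oo).
  apply: cauchy_exP => e e0; have [N HN] := uC e e0.
  by exists (u N); exists N => // j Nj; rewrite /= ball_mdist /=; exact: HN.
have /cvg_ex[l ul] := ucvg.
exists l; first by apply: (closed_cvg A cA _ l ul); exact: nearW.
move=> e e0; have [N _ HN] : \forall i \near \oo, ball l e (u i).
  exact: (cvg_ball ul).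
by exists N => i Ni; have := HN i Ni; rewrite /= ball_mdist /= metric_sym.
Qed.

Lemma countable_dense_seq (T : polishMetricType R) :
  exists f : nat -> T, forall x (e : R), 0 < e -> exists n, mdist x (f n) < e.
Proof.
have [A cA dA] : separable T by exact: separable_axiom.
have A0 : A !=set0.
  by have [x [_ Ax]] := dA setT (ex_intro _ point I) openT; exists x.
have /pfcard_geP[A0'|[f]] := cA; first by move: A0; rewrite A0' => -[].
exists f => x e e0.
have [y [xy Ay]] :=
  dA (ball x e) (ex_intro _ x (ballxx x e0)) (open_ball_metric x e).
have [n _ fn] := 'surj_f Ay.
by exists n; rewrite fn; move: xy; rewrite ball_mdist.
Qed.

(** A dense sequence of [T] may miss [A] altogether. Instead, from each ball of radius [1 / (j + 1)]
    around a term of the sequence that meets [A], one point of [A] is picked; there are countably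
    many such balls. *)
Lemma subset_separable_on (T : polishMetricType R) (A : set T) :
  separable_on A (@mdist R T).
Proof.
have [f fd] := countable_dense_seq T.
pose g (p : nat * nat) := [set a | A a /\ mdist a (f p.1) < p.2.+1%:R^-1].
pose B := \bigcup_(p in [set p | g p !=set0]) [set xget point (g p)].
exists B.
  split; last first.
    by move=> _ [p /= [a ga] ->]; have [] := xgetPex point (ex_intro _ a ga).
  apply: bigcup_countable => [|p _]; first exact: countableP.
  exact: finite_set_countable.
move=> x e Ax e0.
(* With this [k], two radii [1 / (k + 1)] add up to less than [e]: one leg goes from [x] to the
   centre [f n], the other from [f n] to the picked point. *)
pose k := Num.truncn (2 / e).
have ke : 2 / e < k.+1%:R by rewrite /k truncnS_gt.
have k0 : 0 < (k.+1%:R^-1 : R) by rewrite invr_gt0.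
have k2 : (k.+1%:R^-1 : R) + k.+1%:R^-1 < e.
  by rewrite -mulr2n -[ltLHS]mulr_natl ltr_pdivrMr// mulrC -ltr_pdivrMr// mulrC.
have [n xn] := fd x _ k0.
have gx : g (n, k) x by [].
have [Aa an] := xgetPex point (ex_intro _ x gx).
exists (xget point (g (n, k))); first by exists (n, k) => //; exists x.
rewrite (le_lt_trans (metric_triangle x (f n) _))// (lt_trans _ k2)// ltrD//.
by rewrite metric_sym.
Qed.

End Subsets.

(** * Images of a measure under maps that are isometric on its support *)

Section Push.
Context {R : realType}.
Variables (X Y : polishMetricType R).

(** If [f (u i)] tends to [y], then [u] is Cauchy because [f] preserves distances on [A]; its limit
    lies in the complete set [A] and is mapped to [y]. *)
Lemma isometry_on_closed_image (A : set X) (f : X -> Y) :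
  closed A -> isometry_on A f -> closed (f @` A).
Proof.
move=> cA fA y yA.
have /choice[u uP] (k : nat) :
    exists x, A x /\ mdist y (f x) < k.+1%:R^-1.
  have k0 : 0 < (k.+1%:R^-1 : R) by rewrite invr_gt0.
  have [_ [[x Ax <-]]] := yA _ (nbhsx_ballx y _ k0).
  by rewrite ball_mdist /= => ?; exists x.
have small (e : R) : 0 < e ->
    exists N, forall i, (N <= i)%N -> mdist y (f (u i)) < e.
  (* From this index on, [1 / e < i + 1]. *)
  move=> e0; exists (Num.truncn e^-1) => i Ni.
  have [_ h] := uP i; apply: (lt_le_trans h).
  rewrite invf_ple ?posrE//; apply: (le_trans (ltW (truncnS_gt _))).
  by rewrite ler_nat.
have [||x Ax ux] := @closed_complete_on R X A cA u.
- by move=> k; have [] := uP k.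
- move=> e e0; have e20 : 0 < e / 2 by rewrite divr_gt0.
  have [N HN] := small _ e20; exists N => i j Ni Nj.
  have [Ai _] := uP i; have [Aj _] := uP j; rewrite -fA//.
  rewrite (le_lt_trans (metric_triangle _ y _))// [ltRHS]splitr ltrD//.
    by rewrite metric_sym HN.
  by rewrite HN.
exists x => //; apply: mdist_positivity; apply/eqP.
rewrite eq_le mdist_ge0 andbT; apply/ler_addgt0Pl => e e0; rewrite addr0.
have e20 : 0 < e / 2 by rewrite divr_gt0.
have [N HN] := small _ e20; have [N' HN'] := ux _ e20.
pose i := maxn N N'; have [Ai _] := uP i.
rewrite ltW// (le_lt_trans (metric_triangle _ (f (u i)) _))//.
rewrite [ltRHS]splitr ltrD//.
  by rewrite fA// metric_sym HN'// leq_maxr.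
by rewrite metric_sym HN// leq_maxl.
Qed.

Lemma isometry_on_push (m : probability (borel X) R) (f : X -> Y) :
  isometry_on (spt m) f ->
  exists m' : probability (borel Y) R, spt_isom m m' f.
Proof.
move=> fS; have mS := measurable_spt m; have cS := @closed_spt _ _ m.
have mf := (measurable_restrictT (f : borel X -> borel Y) mS).1
  (isometry_on_measurable mS fS).
pose F : {mfun borel X >-> borel Y} :=
  HB.pack ((f : borel X -> borel Y) \_ (spt m))
    (isMeasurableFun.Build _ _ _ _ _ mf).
pose m' : probability (borel Y) R := distribution m F.
have m'E B : measurable B -> m' B = m (spt m `&` f @^-1` B).
  move=> mB; transitivity (m (F @^-1` B)) => //.
  rewrite -spt_full; last first.
    by rewrite -[X in measurable X]setTI; exact: (mf measurableT B mB).
  by congr (m _); apply/seteqP; split=> x /= [Sx]; rewrite patchE mem_set.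
exists m'; split => //; last by move=> B mB; rewrite m'E.
split.
- move=> x Sx V oV Vfx; rewrite m'E; last exact: open_borel.
  have [G [oG Gx GV]] := isometry_on_relcts fS Sx oV Vfx.
  apply: (lt_le_trans (Sx G oG Gx)).
  rewrite -[leLHS](spt_full m (open_borel oG)); apply: le_measure; rewrite ?inE.
  + by apply: measurableI => //; exact: open_borel.
  + by apply: (isometry_on_measurable mS fS) => //; exact: open_borel.
  + by move=> x' [Sx' Gx']; split => //; apply: GV.
- move=> x x'; rewrite !inE => Sx Sx' E.
  by apply: mdist_positivity; rewrite -fS// E mdistxx.
(* A point [y] outside the image of [spt m] has the complement of that closed image as an open
   neighbourhood, and this neighbourhood has mass 0. *)
- move=> y Sy; apply: contrapT => ny.
  have oV : open (~` (f @` spt m)).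
    by rewrite openC; exact: isometry_on_closed_image.
  have := Sy _ oV ny; rewrite m'E; last exact: open_borel.
  rewrite (_ : _ `&` _ = set0) ?measure0 ?ltxx// -subset0.
  by move=> x [Sx]; apply; exists x.
Qed.

End Push.

(** * Embedding an abstract distance on a set into the Urysohn space *)

Section Gluing.
Context {R : realType} (T : choiceType) (S : set T) (rho : T -> T -> R).

(** Carrying the proof in the type lets the metric instance recover [rho] and its axioms from the
    type alone. *)
Definition dist_space (_ : distance_on S rho) : Type := set_type S.

Variable hrho : distance_on S rho.

HB.instance Definition _ := Choice.copy (dist_space hrho) (set_type S).

Let dist (a b : dist_space hrho) : R := rho (val a) (val b).

Let valS (a : dist_space hrho) : S (val a). Proof. exact: set_mem (valP a). Qed.

Let dist_refl a : dist a a = 0. Proof. exact: (distance_refl hrho). Qed.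

Let dist_sep a b : dist a b = 0 -> a = b.
Proof. by move=> ab; apply: val_inj; exact: (distance_separated hrho). Qed.

Let dist_sym a b : dist a b = dist b a.
Proof. exact: (distance_sym hrho). Qed.

Let dist_triangle b a c : dist a c <= dist a b + dist b c.
Proof. exact: (distance_triangle hrho). Qed.

HB.instance Definition _ := @isMetric.Build R (dist_space hrho) dist
  dist_refl dist_sep dist_sym dist_triangle.

Lemma dist_space_separable : separable_on S rho -> separable (dist_space hrho).
Proof.
move=> [A [cA AS] rA]; exists [set a : dist_space hrho | A (val a)].
  apply/countable_injP.
  have /countable_injP[f finj] := cA.
  exists (fun a => f (val a)) => a b; rewrite !inE /= => Aa Ab /finj ab.
  by apply: val_inj; apply: ab; rewrite inE.
move=> V [a Va] oV.
have : nbhs a V by exact: open_nbhs_nbhs.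
move=> /nbhs_ballP[e /= e0 eV].
have [b Ab ab] := rA _ _ (valS a) e0.
exists (exist _ b (mem_set (AS _ Ab))); split => //.
by apply: eV; rewrite ball_mdist.
Qed.

Lemma urysohn_dist_embedding (U : polishMetricType R) :
  is_urysohn U -> separable_on S rho -> exists h : T -> U,
  forall x y, S x -> S y -> mdist (h x) (h y) = rho x y.
Proof.
move=> hU sS; have [f fi] := urysohn_universal hU (dist_space_separable sS).
exists (fun x => if pselect (S x) is left Sx then f (exist _ x (mem_set Sx))
                 else point).
move=> x y Sx Sy; case: pselect => // Sx'; case: pselect => // Sy'.
by rewrite fi.
Qed.

End Gluing.

(** * Comparison of integrals off a set of small mass *)

Section Integrals.
Context {R : realType}.

(** On [D], [f] is at most [g + e] plus the indicator of the complement of [E], since [f <= 1]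
    there. The constant [e] integrates to at most [e] and so does the indicator, hence the error
    [e + e]. *)
Lemma le_integral_approx d (T : measurableType d) (P : probability T R)
    (D E : set T) (f g : T -> R) (e : R) :
  measurable D -> measurable E -> (P (~` E) <= e%:E)%E ->
  measurable_fun D f -> measurable_fun D g -> 0 <= e ->
  (forall x, D x -> 0 <= f x <= 1) -> (forall x, D x -> 0 <= g x) ->
  (forall x, D x -> E x -> f x <= g x + e) ->
  (\int[P]_(x in D) (f x)%:E <= \int[P]_(x in D) (g x)%:E + (e + e)%:E)%E.
Proof.
move=> mD mE PE mf mg e0 f01 g0 fg.
have mE' : measurable (~` E) by exact: measurableC.
apply: (@le_trans _ _
  (\int[P]_(x in D) ((g x)%:E + (e%:E + (\1_(~` E) x)%:E)))%E).
  apply: ge0_le_integral => //.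
  - by move=> x Dx; rewrite lee_fin; have /andP[] := f01 x Dx.
  - exact/measurable_EFinP.
  - apply: emeasurable_funD; first exact/measurable_EFinP.
    apply: emeasurable_funD; first exact: measurable_cst.
    by apply/measurable_EFinP; exact: measurable_indic.
  - move=> x Dx; rewrite -!EFinD lee_fin indicE.
    have [Ex|Ex] := pselect (E x).
      by rewrite memNset ?addr0 ?fg//; exact: (fun h => h Ex).
    have /andP[_ f1] := f01 x Dx; rewrite mem_set//=.
    by rewrite (le_trans f1)// addrA lerDr addr_ge0// g0.
rewrite ge0_integralD//; first last.
- apply: emeasurable_funD; first exact: measurable_cst.
  by apply/measurable_EFinP; exact: measurable_indic.
- by move=> x _; rewrite adde_ge0// lee_fin.
- exact/measurable_EFinP.
apply: leeD => //; rewrite ge0_integralD//; first last.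
- by apply/measurable_EFinP; exact: measurable_indic.
rewrite integral_indic// integral_cst// EFinD; apply: leeD.
  by rewrite -[leRHS]mule1; apply: lee_wpmul2l => //; exact: probability_le1.
by apply: le_trans PE; apply: le_measure; rewrite ?inE//; exact: measurableI.
Qed.

End Integrals.

(** * Transport cost between isometric images of two measures *)

Section Transport.
Context {R : realType}.

(** [k] and [l] are controlled only on [A] and [B], so measurability comes from the superlevel sets
    of the distance being relatively open in the product of [A] and [B]. *)
Lemma measurable_truncated_dist (X Y U : polishMetricType R) (A : set X)
    (B : set Y) (k : X -> U) (l : Y -> U) :
  measurable (A `*` B : set (borel (X * Y)%type)) ->
  isometry_on A k -> isometry_on B l ->
  measurable_fun (A `*` B : set (borel (X * Y)%type))
    ((fun z => Num.min (mdist (k z.1) (l z.2)) 1) : borel (X * Y)%type -> R).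
Proof.
move=> mAB kA lB.
apply: measurable_minr; last exact: measurable_cst.
move=> mD; apply: (measurability _ (RGenOInfty.measurableE R)) => //.
move=> _ [_ [c ->] <-].
apply: (@relopen_measurable [the ptopologicalType of (X * Y)%type]) => //.
move=> [x y] [/= Ax By]; rewrite in_itv /= andbT => cr.
(* Half of the gap: moving [x] and [y] by less than [e] each lowers the distance by less than the
   whole gap, so it stays above [c]. *)
pose e := (mdist (k x) (l y) - c) / 2.
have e0 : 0 < e by rewrite divr_gt0// subr_gt0.
exists (ball x e `*` ball y e); split.
- by apply: openX_prod; exact: open_ball_metric.
- by split; exact: ballxx.
- move=> [a b] [[/= xa yb] [/= Aa Bb]]; rewrite in_itv /= andbT.
  have h1 := metric_triangle (k x) (k a) (l y).
  have h2 := metric_triangle (k a) (l b) (l y).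
  rewrite kA// in h1; rewrite [mdist (l b) _]metric_sym lB// in h2.
  move: xa yb; rewrite !ball_mdist /= /e => xa yb.
  lra.
Qed.

Variables (X Y U : polishMetricType R).
Variables (m : probability (borel X) R) (n : probability (borel Y) R).
Variables (m' n' : probability (borel U) R) (k : X -> U) (l : Y -> U).
Hypotheses (hk : spt_isom m m' k) (hl : spt_isom n n' l).
Variable pi : probability (borel (X * Y)%type) R.
Hypothesis hpi : Adm m n pi.

(** The image of [pi] under the pair [(k, l)] couples [m'] and [n'], and its cost is the right-hand
    side. *)
Lemma W_le_spt_isom :
  (W m' n' <= \int[pi]_(z in spt m `*` spt n)
    (Num.min (mdist (k z.1) (l z.2)) 1)%:E)%E.
Proof.
have [_ ki kp] := hk; have [_ li lp] := hl; have [q1 q2] := hpi.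
pose S := spt m `*` spt n.
have mS : measurable (S : set (borel (X * Y)%type)) by exact: measurable_sptX.
pose kl (z : X * Y) : U * U := (k z.1, l z.2).
have mkl : measurable_fun (S : set (borel (X * Y)%type))
    (kl : borel (X * Y)%type -> borel (U * U)%type).
  apply: (@relcts_measurable [the ptopologicalType of (X * Y)%type]
    [the ptopologicalType of (U * U)%type] S kl) => //.
  move=> [x y] V [/= Sx Sy]; rewrite openE => + Vxy.
  move=> /(_ _ Vxy)[[A B] [/= xA yB] ABV].
  have [V1 [oV1 V1x V1A]] :=
    isometry_on_relcts ki Sx (@open_interior _ A) xA.
  have [V2 [oV2 V2y V2B]] :=
    isometry_on_relcts li Sy (@open_interior _ B) yB.
  exists (V1 `*` V2); split => //; first exact: openX_prod.
  move=> [a b] [[/= V1a V2b] [/= Sa Sb]]; apply: ABV; split => /=.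
    by apply: interior_subset; apply: V1A.
  by apply: interior_subset; apply: V2B.
(* [h] is [kl] on [S] and constant elsewhere, which makes it measurable on the whole product; [pi]
   gives no mass to the complement of [S]. *)
pose h : borel (X * Y)%type -> borel (U * U)%type :=
  (kl : borel (X * Y)%type -> borel (U * U)%type) \_ S.
have mh : measurable_fun setT h.
  exact: (measurable_restrictT
    (kl : borel (X * Y)%type -> borel (U * U)%type) mS).1.
have hE z : S z -> h z = kl z by move=> Sz; rewrite /h patchE mem_set.
pose hm : {mfun borel (X * Y)%type >-> borel (U * U)%type} :=
  HB.pack h (isMeasurableFun.Build _ _ _ _ _ mh).
pose pi' : probability (borel (U * U)%type) R := distribution pi hm.
have pi'E B : measurable B -> pi' B = pi (S `&` kl @^-1` B).
  move=> mB; transitivity (pi (h @^-1` B)) => //.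
  rewrite -(Adm_full hpi); last first.
    by rewrite -[X in measurable X]setTI; exact: (mh measurableT B mB).
  by congr (pi _); apply/seteqP; split=> z /= [Sz]; rewrite hE.
have hpi' : Adm m' n' pi'.
  split=> B mB; rewrite pi'E.
  - have mA : measurable (spt m `&` k @^-1` B : set (borel X)).
      exact: (spt_isom_measurable hk (measurable_spt m)).
    rewrite -kp// -q1// -[RHS](Adm_full hpi); last first.
      exact: (@measurable_fst_preimage _ X Y _ mA).
    congr (pi _); apply/seteqP; split=> -[x y] /= [[/= Sx Sy]].
      by move=> Bx; split.
    by move=> [_ Bx].
  - exact: (@measurable_fst_preimage _ U U _ mB).
  - have mA : measurable (spt n `&` l @^-1` B : set (borel Y)).
      exact: (spt_isom_measurable hl (measurable_spt n)).
    rewrite -lp// -q2// -[RHS](Adm_full hpi); last first.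
      exact: (@measurable_snd_preimage _ X Y _ mA).
    congr (pi _); apply/seteqP; split=> -[x y] /= [[/= Sx Sy]].
      by move=> Bx; split.
    by move=> [_ Bx].
  - exact: (@measurable_snd_preimage _ U U _ mB).
apply: ge_ereal_inf; exists (\int[pi']_z (Num.min (mdist z.1 z.2) 1)%:E)%E.
  by exists pi'.
have min0 (z : U * U) : (0 <= (Num.min (mdist z.1 z.2) 1)%:E)%E.
  by rewrite lee_fin le_min mdist_ge0 ler01.
have mmin : measurable_fun (setT : set (borel (U * U)%type))
    ((fun z => (Num.min (mdist z.1 z.2) 1)%:E)
      : borel (U * U)%type -> \bar R).
  apply/measurable_EFinP; rewrite -setXTT.
  apply: (@measurable_truncated_dist U U U setT setT id id) => //.
  by rewrite setXTT; exact: measurableT.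
rewrite (ge0_integral_pushforward mh)// preimage_setT.
have NS : pi (~` S) = 0%E by exact: Adm_sptXC.
rewrite (ge0_negligible_integral (measurableC mS) measurableT _ _ NS)//.
- rewrite setTD setCK le_eqVlt; apply/orP; left; apply/eqP.
  by apply: eq_integral => z; rewrite inE => Sz /=; rewrite hE.
- exact: measurableT_comp.
- by move=> z _; exact: min0.
Qed.

End Transport.

Lemma le_min1_add (R : realType) (a b c : R) :
  0 <= c -> a <= b + c -> Num.min a 1 <= Num.min b 1 + c.
Proof.
by move=> c0 abc; rewrite addr_minl le_min !ge_min abc /= lerDl c0 orbT.
Qed.

(** * The inequality between [D] and [W] in a common space *)

Section Shift.
Context {R : realType} (U : polishMetricType R).
Variables (mu nu : probability (borel U) R).

Definition shifted_dist (c : R) (a b : U + U) : R :=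
  match a, b with
  | inl x, inl y | inr x, inr y => mdist x y
  | inl x, inr y | inr x, inl y => mdist x y + c
  end.

(** Points of different copies are at distance at least [c], so a Cauchy sequence eventually stays
    in one copy, where the closed support provides its limit. *)
Lemma shifted_dist_complete (c : R) : 0 < c ->
  complete_on (spt_sum mu nu) (shifted_dist c).
Proof.
move=> c0 u uS uC; have [N HN] := uC c c0.
have sep (x y : U) : (mdist x y + c < c) = false.
  by apply/negbTE; rewrite -leNgt lerDr mdist_ge0.
have cauchy_tail e : 0 < e -> exists M, forall i j, (M <= i)%N -> (M <= j)%N ->
    shifted_dist c (u (N + i)%N) (u (N + j)%N) < e.
  move=> e0; have [M HM] := uC e e0; exists M => i j Mi Mj.
  by apply: HM; rewrite (leq_trans _ (leq_addl _ _)).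
case uN : (u N) => [z|z].
- have /choice[v uv] : forall i, exists x, u (N + i)%N = inl x.
    move=> i; have := HN N (N + i)%N (leqnn _) (leq_addr _ _); rewrite uN.
    by case: (u (N + i)%N) => [x _|x] /=; [exists x|rewrite sep].
  have [||x Sx vx] := closed_complete_on (@closed_spt _ _ mu) (u := v).
  + by move=> i; have := uS (N + i)%N; rewrite uv.
  + move=> e /cauchy_tail[M HM]; exists M => i j Mi Mj.
    by have := HM i j Mi Mj; rewrite !uv.
  exists (inl x) => // e /vx[M HM]; exists (N + M)%N => i Mi.
  have Ni : (N <= i)%N by rewrite (leq_trans _ Mi)// leq_addr.
  by rewrite -(subnKC Ni) uv /=; apply: HM; rewrite leq_subRL.
- have /choice[v uv] : forall i, exists x, u (N + i)%N = inr x.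
    move=> i; have := HN N (N + i)%N (leqnn _) (leq_addr _ _); rewrite uN.
    by case: (u (N + i)%N) => [x|x _] /=; [rewrite sep|exists x].
  have [||x Sx vx] := closed_complete_on (@closed_spt _ _ nu) (u := v).
  + by move=> i; have := uS (N + i)%N; rewrite uv.
  + move=> e /cauchy_tail[M HM]; exists M => i j Mi Mj.
    by have := HM i j Mi Mj; rewrite !uv.
  exists (inr x) => // e /vx[M HM]; exists (N + M)%N => i Mi.
  have Ni : (N <= i)%N by rewrite (leq_trans _ Mi)// leq_addr.
  by rewrite -(subnKC Ni) uv /=; apply: HM; rewrite leq_subRL.
Qed.

Lemma shifted_dist_Cpl (c : R) : 0 < c -> Cpl mu nu (shifted_dist c).
Proof.
move=> c0; split => //.
- split.
  + by case=> x _ /=; rewrite mdistxx.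
  + case=> x [] y _ _ /=; try by move/mdist_positivity ->.
      by move=> E; exfalso; have := mdist_ge0 x y; lra.
    by move=> E; exfalso; have := mdist_ge0 x y; lra.
  + by case=> x [] y _ _ /=; rewrite metric_sym.
  + case=> y [] x [] z _ _ _ /=; have := metric_triangle x y z; lra.
- exact: shifted_dist_complete.
- have [A [cA AS] Ad] := subset_separable_on (spt mu).
  have [B [cB BS] Bd] := subset_separable_on (spt nu).
  exists (inl @` A `|` inr @` B).
    split; last by move=> _ [] [a ? <-] /=; [exact: AS|exact: BS].
    rewrite -bigcup2E; apply: bigcup_countable => [|i _].
      exact: countableP.
    case: i => [|[|i]] /=; last exact: countable0.
      exact: (sub_countable (card_image_le _ _) cA).
    exact: (sub_countable (card_image_le _ _) cB).
  case=> x e Sx e0.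
  + by have [a Aa xa] := Ad x e Sx e0; exists (inl a) => //; left; exists a.
  + by have [b Bb xb] := Bd x e Sx e0; exists (inr b) => //; right; exists b.
Qed.

Lemma D_measures_le_W : (D_measures mu nu <= W mu nu)%E.
Proof.
apply: le_ereal_inf_tmp => _ [pi hpi <-]; apply/lee_addgt0Pr => e e0.
have e20 : 0 < e / 2 by rewrite divr_gt0.
have mS : measurable (spt mu `*` spt nu : set (borel (U * U)%type)).
  exact: measurable_sptX.
have hrho := shifted_dist_Cpl e20.
apply: ge_ereal_inf; exists (cpl_cost mu nu (shifted_dist (e / 2)) pi).
  by exists (shifted_dist (e / 2)) => //; exists pi.
have mdistU (A B : set U) : measurable (A `*` B : set (borel (U * U)%type)) ->
    measurable_fun (A `*` B : set (borel (U * U)%type))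
    ((fun z => Num.min (mdist z.1 z.2) 1) : borel (U * U)%type -> R).
  by move=> mAB; apply: (@measurable_truncated_dist _ U U U A B id id).
(* The shift adds at most [e / 2] to the cost at every point, so the comparison of integrals is
   applied with empty exceptional set. *)
apply: (@le_trans _ _ (\int[pi]_(z in spt mu `*` spt nu)
    (Num.min (mdist z.1 z.2) 1)%:E + (e / 2 + e / 2)%:E)%E).
  apply: (@le_integral_approx _ _ (borel (U * U)%type) pi _ setT) => //.
  - by rewrite setCT measure0 lee_fin ltW.
  - by apply/measurable_EFinP; exact: cpl_cost_measurable.
  - exact: mdistU.
  - exact: ltW.
  - move=> z _; rewrite le_min ler01 addr_ge0 ?mdist_ge0 ?(ltW e20)//=.
    by rewrite ge_min lexx orbT.
  - by move=> z _; rewrite le_min mdist_ge0 ler01.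
  - by move=> z _ _; apply: le_min1_add => //; exact: ltW.
(* [W] integrates over the whole product; the integrand is nonnegative, so enlarging the domain from
   the supports does not decrease the integral. *)
rewrite -splitr leeD2r//; apply: ge0_subset_integral => //.
- by apply/measurable_EFinP; rewrite -setXTT; apply: mdistU; rewrite setXTT.
- by move=> z _; rewrite lee_fin le_min mdist_ge0 ler01.
Qed.

End Shift.

(** * Realigning copies in the Urysohn space: bounding both suprema of [W_H] by [D] *)

Section Approximation.
Context {R : realType} (U : polishMetricType R).

(** The two errors [e] are the excess of the distance over [rho] on [E] and the mass of the
    complement of [E], where the truncated cost is at most 1. *)
Lemma W_le_cpl_cost (X Y : polishMetricType R)
    (m : probability (borel X) R) (n : probability (borel Y) R)
    (m' n' : probability (borel U) R) (k : X -> U) (l : Y -> U)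
    (rho : X + Y -> X + Y -> R) (pi : probability (borel (X * Y)%type) R)
    (E : set (borel (X * Y)%type)) (e : R) :
  spt_isom m m' k -> spt_isom n n' l -> Cpl m n rho -> Adm m n pi ->
  measurable E -> (pi (~` E) <= e%:E)%E -> 0 <= e ->
  (forall x y, spt m x -> spt n y -> E (x, y) ->
    mdist (k x) (l y) <= rho (inl x) (inr y) + e) ->
  (W m' n' <= cpl_cost m n rho pi + (e + e)%:E)%E.
Proof.
move=> hk hl hrho hpi mE piE e0 klrho.
apply: (le_trans (W_le_spt_isom hk hl hpi)).
have mS : measurable (spt m `*` spt n : set (borel (X * Y)%type)).
  exact: measurable_sptX.
have [_ ki _] := hk; have [_ li _] := hl.
apply: (@le_integral_approx _ _ (borel (X * Y)%type) pi _ E) => //.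
- exact: measurable_truncated_dist.
- by apply/measurable_EFinP; exact: cpl_cost_measurable.
- by move=> z _; rewrite le_min mdist_ge0 ler01 ge_min lexx orbT.
- case=> x y [/= Sx Sy]; rewrite le_min ler01 andbT.
  have [[r0 _ rS rT] _ _ _ _] := hrho.
  (* Nonnegativity of [rho] is not an axiom of [distance_on]; it follows from the triangle
     inequality along [x], [y], [x]. *)
  have := rT (inr y) (inl x) (inl x) Sx Sy Sx.
  by rewrite r0// (rS (inr y))//; lra.
- case=> x y [/= Sx Sy] Exy; apply: le_min1_add => //.
  exact: klrho.
Qed.

(** Balls of radius [e] around a countable dense subset cover the support, which has full mass; by
    continuity from below, finitely many of them carry mass more than [1 - e]. *)
Lemma finite_net (m : probability (borel U) R) (e : R) : 0 < e ->
  exists F : set U, [/\ finite_set F, F `<=` spt m &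
    (m (~` \bigcup_(a in F) ball a e) <= e%:E)%E].
Proof.
move=> e0; have [A [cA AS] Ad] := subset_separable_on (spt m).
have A0 : A !=set0.
  have [x [Sx _]] : spt m `&` setT !=set0.
    by apply: spt_setI_nonempty; [exact: openT|rewrite probability_setT].
  by have [a Aa _] := Ad x e Sx e0; exists a.
have /pfcard_geP[A0'|[f]] := cA; first by move: A0; rewrite A0' => -[].
pose B (k : nat) : set (borel U) := \bigcup_(a in f @` `I_k) ball a e.
have oB k : open (B k) by apply: bigcup_open => a _; exact: open_ball_metric.
have mB k : measurable (B k) by exact: open_borel.
have oBU : open (\bigcup_k B k) by exact: bigcup_open.
have mBU : measurable (\bigcup_k B k : set (borel U)) by exact: open_borel.
have mBU1 : m (\bigcup_k B k) = 1%E.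
  apply/eqP; rewrite eq_le probability_le1//= -(probability_setT m).
  rewrite -[leLHS](spt_full m)// setIT; apply: le_measure; rewrite ?inE//.
    exact: measurable_spt.
  move=> x Sx; have [a Aa xa] := Ad x e Sx e0.
  have [k _ fk] := 'surj_f Aa.
  (* The index set of [B k] stops before [k], so the ball around [f k] first enters in [B k.+1]. *)
  exists k.+1 => //; exists a; first by exists k => //=.
  by rewrite ball_mdist /= metric_sym.
have Bm : m (B k) @[k --> \oo] --> 1%E.
  rewrite -mBU1; apply: nondecreasing_cvg_mu => // i j ij.
  apply/subsetPset; apply: bigcup_subset => _ [k /= ki <-].
  by exists k => //=; exact: leq_trans ij.
have [k _ Bk] : \forall k \near \oo, ((1 - e)%:E < m (B k))%E.
  apply: (Bm [set x | ((1 - e)%:E < x)%E]).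
  apply: (@nbhs_open_ereal_gt _ 1 (fun=> 1 - e)).
  by rewrite ltrBlDr ltrDl.
exists (f @` `I_k); split.
- exact/finite_image/finite_II.
- by move=> _ [i _ <-]; apply: AS; apply: funS.
- rewrite [leLHS](probability_setC m (mB k)).
  have := Bk k (leqnn k); rewrite /=.
  have : m (B k) \is a fin_num by exact: fin_num_measure.
  by move=> /fineK <-; rewrite -EFinB !lte_fin lee_fin; lra.
Qed.

Lemma spt_isom_id (m : probability (borel U) R) : spt_isom m m id.
Proof.
split => //; first by split => // x Sx; exists x.
by move=> B mB; rewrite preimage_id spt_full.
Qed.

Hypothesis hU : is_urysohn U.

(** Ultrahomogeneity concerns finite sets, so [h] is undone exactly on a finite net of [spt m]; the
    isometries [psi] and [h] then keep the error small near the net. *)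
Lemma urysohn_realign (m : probability (borel U) R) (h : U -> U) (e : R) :
  isometry_on (spt m) h -> 0 < e -> exists psi : U -> U, Defs.isometry psi /\
  exists E : set (borel U), [/\ measurable E, (m (~` E) <= e%:E)%E &
    forall x, spt m x -> E x -> mdist x (psi (h x)) <= e].
Proof.
move=> hi e0; have e20 : 0 < e / 2 by rewrite divr_gt0.
have [F [fF FS mF]] := finite_net m e20.
(* [phi] inverts [h] on the image of [F]; the preimage in [F] is unique because [h] is isometric on
   [spt m]. *)
pose phi u := xget point [set a | F a /\ h a = u].
have phiK a : F a -> phi (h a) = a.
  move=> Fa; have [Fb hb] :=
    @xgetPex _ point [set b | F b /\ h b = h a] (ex_intro _ a (conj Fa erefl)).
  apply: mdist_positivity; rewrite -hi//; try exact: FS.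
  by rewrite [X in mdist X]hb mdistxx.
have [|psi [psii _ psiE]] :=
    urysohn_ultrahomogeneous hU (phi := phi) (finite_image h fF).
  by move=> _ _ [a Fa <-] [b Fb <-]; rewrite !phiK// hi//; exact: FS.
exists psi; split => //; exists (\bigcup_(a in F) ball a (e / 2)); split.
- by apply: open_borel; apply: bigcup_open => a _; exact: open_ball_metric.
- by apply: (le_trans mF); rewrite lee_fin; lra.
- move=> x Sx [a Fa]; rewrite ball_mdist /= => ax.
  (* Since [psi (h a) = a], both legs have the length of [a] to [x], which is below [e / 2]. *)
  apply: (le_trans (metric_triangle _ (psi (h a)) _)).
  rewrite psii// hi//; last exact: FS.
  by rewrite psiE ?phiK// metric_sym; lra.
Qed.

Variables (mu nu : probability (borel U) R).

Lemma cpl_urysohn_embedding (rho : U + U -> U + U -> R) : Cpl mu nu rho ->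
  exists k l : U -> U, [/\ isometry_on (spt mu) k, isometry_on (spt nu) l &
    forall x y, spt mu x -> spt nu y ->
      mdist (k x) (l y) = rho (inl x) (inr y)].
Proof.
move=> [r0 _ rS rX rY]; have [h hE] := urysohn_dist_embedding r0 hU rS.
exists (h \o inl), (h \o inr); split.
- by move=> x x' Sx Sx' /=; rewrite hE// rX.
- by move=> y y' Sy Sy' /=; rewrite hE// rY.
- by move=> x y Sx Sy /=; rewrite hE.
Qed.

(** [mu] stays in place, and [psi] moves its copy under [k] back near it, carrying along the copy of
    [nu], whose image measure is the competitor [nu']. *)
Lemma ereal_inf_W_le_l :
  (ereal_inf [set W mu nu' | nu' in [set nu' | isomorphic nu nu']]
    <= D_measures mu nu)%E.
Proof.
apply: le_ereal_inf_tmp => _ [rho hrho [pi hpi <-]].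
apply/lee_addgt0Pr => e e0; have e20 : 0 < e / 2 by rewrite divr_gt0.
have [k [l [ki li klE]]] := cpl_urysohn_embedding hrho.
have [psi [psii [E [mE muE Ek]]]] := urysohn_realign ki e20.
have [nu' hnu'] : exists nu' : probability (borel U) R,
    spt_isom nu nu' (psi \o l).
  by apply: isometry_on_push => y y' Sy Sy' /=; rewrite psii// li.
apply: ge_ereal_inf; exists (W mu nu').
  by exists nu' => //; exists (psi \o l).
(* [e / 2] bounds both the displacement on [E] and the mass missed by [E]. *)
rewrite [in leRHS](splitr e).
apply: (@W_le_cpl_cost U U mu nu mu nu' id (psi \o l) rho pi
  ((fst : U * U -> U) @^-1` E)) => //; last 1 first.
- move=> x y Sx Sy Ex /=; rewrite addrC.
  apply: (le_trans (metric_triangle _ (psi (k x)) _)).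
  by rewrite lerD ?Ek// psii// klE.
- exact: spt_isom_id.
- exact: (@measurable_fst_preimage _ U U _ mE).
(* The exceptional set depends on the first coordinate only, and the first marginal of [pi] is
   [mu]. *)
- by have [q1 _] := hpi; have := q1 _ (measurableC mE) => /= ->.
- exact: ltW.
Qed.

(** Here the copy of [nu] is realigned and the copy of [mu] follows; the exceptional set is measured
    by the second marginal. *)
Lemma ereal_inf_W_le_r :
  (ereal_inf [set W mu' nu | mu' in [set mu' | isomorphic mu mu']]
    <= D_measures mu nu)%E.
Proof.
apply: le_ereal_inf_tmp => _ [rho hrho [pi hpi <-]].
apply/lee_addgt0Pr => e e0; have e20 : 0 < e / 2 by rewrite divr_gt0.
have [k [l [ki li klE]]] := cpl_urysohn_embedding hrho.
have [psi [psii [E [mE nuE El]]]] := urysohn_realign li e20.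
have [mu' hmu'] : exists mu' : probability (borel U) R,
    spt_isom mu mu' (psi \o k).
  by apply: isometry_on_push => x x' Sx Sx' /=; rewrite psii// ki.
apply: ge_ereal_inf; exists (W mu' nu).
  by exists mu' => //; exists (psi \o k).
rewrite [in leRHS](splitr e).
apply: (@W_le_cpl_cost U U mu nu mu' nu (psi \o k) id rho pi
  ((snd : U * U -> U) @^-1` E)) => //; last 1 first.
- move=> x y Sx Sy Ey /=.
  apply: (le_trans (metric_triangle _ (psi (l y)) _)).
  by rewrite psii// klE// lerD2l metric_sym El.
- exact: spt_isom_id.
- exact: (@measurable_snd_preimage _ U U _ mE).
- by have [_ q2] := hpi; have := q2 _ (measurableC mE) => /= ->.
- exact: ltW.
Qed.

End Approximation.

(** [D_measures] is constant on isomorphism classes. It is therefore below [W mu nu'] for every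
    [nu'] in the class of [nu], hence below the first supremum, tested at [mu]. Conversely, each
    supremum is bounded at an arbitrary representative, where the realignment bounds apply. *)
Lemma D_measures_W_H (R : realType) (U : polishMetricType R) :
  is_urysohn U -> forall mu nu : probability (borel U) R,
  D_measures mu nu = W_H (meas_class mu) (meas_class nu).
Proof.
move=> hU mu nu; apply/eqP; rewrite eq_le /W_H; apply/andP; split.
- rewrite le_max; apply/orP; left; apply: le_ereal_sup_tmp.
  eexists; first by exists mu.
  apply: le_ereal_inf_tmp => _ [nu' /meas_classP nunu' <-].
  rewrite (D_measures_isom (isomorphic_refl mu) (isomorphic_sym nunu')).
  exact: D_measures_le_W.
- rewrite ge_max; apply/andP; split.
  + apply: ge_ereal_sup => _ [mu' /meas_classP mumu' <-].
    rewrite -(D_measures_isom mumu' (isomorphic_refl nu)).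
    apply: le_trans (ereal_inf_W_le_l hU mu' nu).
    apply: ereal_inf_le_tmp => _ [nu' nunu' <-]; exists nu' => //.
    exact/meas_classP/isomorphic_sym.
  + apply: ge_ereal_sup => _ [nu' /meas_classP nunu' <-].
    rewrite -(D_measures_isom (isomorphic_refl mu) nunu').
    apply: le_trans (ereal_inf_W_le_r hU mu nu').
    apply: ereal_inf_le_tmp => _ [mu' mumu' <-]; exists mu' => //.
    exact/meas_classP/isomorphic_sym.
Qed.

Theorem proposition5p1 (R : realType) (U : polishMetricType R)
  (hU : is_urysohn U) (x y : X1 R) : D x y = d_mG hU x y.
Proof.
(* Each space is isomorphic to its image measure in [U], so [D] may be computed between measures on
   [U]. *)
rewrite /d_mG /Phi -D_measures_W_H//; apply: D_measures_isom.
- by eexists; exact: isometric_push_isom.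
- by eexists; exact: isometric_push_isom.
Qed.
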